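(* Let $m\in\{1,2,\ldots\}$ and let $\check\rho,\hat\rho>0$ with $\hat\rho=n\check\rho$ for some integer $n\ge 2$. The operator $I:S_{\hat\rho}\to S_{\check\rho}$, $I(M)=B_{\hat\rho/2}(M)\cap\Delta_{\check\rho}$, satisfies $I(\Delta_{\hat\rho})=\Delta_{\check\rho}$. It has the set-theoretical properties (i) $I(\hat M\cup\hat M')=I(\hat M)\cup I(\hat M')$ for all $\hat M,\hat M'\in S_{\hat\rho}$; (ii) $\hat M\subset\hat M'$ implies $I(\hat M)\subset I(\hat M')$ for all $\hat M,\hat M'\in S_{\hat\rho}$; (iii) $I(\hat x+\hat M)=\hat x+I(\hat M)$ for all $\hat M\in S_{\hat\rho}$ and $\hat x\in\Delta_{\hat\rho}$; the approximation properties (iv) $\mathrm{d}_H(I(\hat M),\hat M)\le\hat\rho/2$ for all $\hat M\in S_{\hat\rho}$; (v) $I(\hat M)\in V_{\hat\rho}^{\check\rho}(\hat M)$ for all $\hat M\in S_{\hat\rho}$; (vi) $I(\hat M)\subset\check M$ for all $\hat M\in S_{\hat\rho}$ and all $\check M\in V_{\hat\rho}^{\check\rho}(\hat M)$; and the topology-related properties (vii) $I(\hat M)\in C_{\check\rho}$ for all $\hat M\in C_{\hat\rho}$; (viii) $\partial^0_{\check\rho}I(\hat M)\subset I(\partial^0_{\hat\rho}\hat M)$ for all $\hat M\in S_{\hat\rho}$.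
   Context: $\mathbb{R}^m$ carries the maximum norm $\|x\|_\infty=\max_{1\le j\le m}|x_j|$. For nonempty $A,A'\subset\mathbb{R}^m$ let $\mathrm{d}(A,A')=\sup_{x\in A}\inf_{x'\in A'}\|x-x'\|_\infty$ and $\mathrm{d}_H(A,A')=\max\{\mathrm{d}(A,A'),\mathrm{d}(A',A)\}$, with $\mathrm{d}(A,\emptyset)=\infty$ for nonempty $A$; for a point $x$, $\mathrm{d}(x,A)=\mathrm{d}(\{x\},A)$. For $A\subset\mathbb{R}^m$ and $\delta>0$ let $B_\delta(A)=\{x\in\mathbb{R}^m:\mathrm{d}(x,A)\le\delta\}$ (so $B_\delta(\emptyset)=\emptyset$). $M^c$ is the complement in $\mathbb{R}^m$. For $\rho>0$: $\Delta_\rho=\rho\mathbb{Z}^m$ and $S_\rho=\{M\subset\Delta_\rho:M\neq\emptyset\}$. For $M\subset\Delta_\rho$: $\partial^0_\rho M=\{x\in M:\exists z\in M^c\cap\Delta_\rho,\ \|x-z\|_\infty=\rho\}$. Paths: for $x,z\in\Delta_\rho$, $P_\rho(x,z)$ is the set of finite sequences $p=(\xi_0,\ldots,\xi_k)$ in $\Delta_\rho$, $k\in\{0,1,2,\ldots\}$, with $\xi_0=x$, $\xi_k=z$ and $\|\xi_\ell-\xi_{\ell-1}\|_\infty\le\rho$ for $\ell=1,\ldots,k$; $L(p)=k$, $p(\ell)=\xi_\ell$. Connected sets: $C_\rho=\{M\in S_\rho:\forall x,x'\in M\ \exists p\in P_\rho(x,x')\ \text{with}\ p(\ell)\in M\ \text{for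 all integers}\ 0\le\ell\le L(p)\}$. For $\rho,\rho'>0$ and $M\in S_\rho$, the Voronoi covers of $M$ in $S_{\rho'}$ are $V_\rho^{\rho'}(M)=\{M'\in S_{\rho'}:B_{\rho/2}(M)\subset B_{\rho'/2}(M')\}$. In (viii), if $\partial^0_{\hat\rho}\hat M=\emptyset$, then $I(\emptyset)$ is understood via the same formula, i.e. $I(\emptyset)=\emptyset$. *)

(* Defs.v *)
From mathcomp Require Import all_boot all_order all_algebra.
From mathcomp Require Import all_classical all_reals all_analysis.

Set Implicit Arguments.
Unset Strict Implicit.
Unset Printing Implicit Defensive.

Import Order.TTheory GRing.Theory Num.Theory.
Import numFieldNormedType.Exports.

Local Open Scope classical_set_scope.
Local Open Scope ring_scope.

(* R^m is 'rV[R]_m, on which the library norm `|x| is the maximum norm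
   (see mx_normrE). *)

(* As ereal_inf set0 = +oo, setdist A set0 = +oo for nonempty A. *)
Definition setdist (R : realType) (m : nat) (A A' : set 'rV[R]_m) : \bar R :=
  ereal_sup [set ereal_inf [set (`|x - x'|)%:E | x' in A'] | x in A].

Definition hausdorff_dist (R : realType) (m : nat) (A A' : set 'rV[R]_m) :
    \bar R :=
  Order.max (setdist A A') (setdist A' A).

Definition nbhd (R : realType) (m : nat) (delta : R) (A : set 'rV[R]_m) :
    set 'rV[R]_m :=
  [set x | (setdist [set x] A <= delta%:E)%E].

Definition grid (R : realType) (m : nat) (rho : R) : set 'rV[R]_m :=
  [set rho *: map_mx intr k | k in [set: 'rV[int]_m]].

Definition grid_sets (R : realType) (m : nat) (rho : R) :
    set (set 'rV[R]_m) :=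
  [set M | M `<=` grid rho /\ M !=set0].

Definition boundary0 (R : realType) (m : nat) (rho : R) (M : set 'rV[R]_m) :
    set 'rV[R]_m :=
  [set x | M x /\ exists2 z, (~` M `&` grid rho) z & `|x - z| = rho].

(* A path (xi_0, ..., xi_k) is the nonempty sequence [:: xi_0; ...; xi_k]. *)
Definition path_length (R : realType) (m : nat) (p : seq 'rV[R]_m) : nat :=
  (size p).-1.

Definition grid_paths (R : realType) (m : nat) (rho : R) (x z : 'rV[R]_m) :
    set (seq 'rV[R]_m) :=
  [set p | [/\ (0 < size p)%N,
               forall l, (l <= path_length p)%N -> grid rho p`_l,
               p`_0 = x,
               p`_(path_length p) = z &
               forall l, (1 <= l <= path_length p)%N ->
                 `|p`_l - p`_(l.-1)| <= rho]].

Definition connected_sets (R : realType) (m : nat) (rho : R) :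
    set (set 'rV[R]_m) :=
  [set M | grid_sets rho M /\
     forall x x', M x -> M x' ->
       exists2 p, grid_paths rho x x' p &
         forall l, (l <= path_length p)%N -> M p`_l].

Definition voronoi_covers (R : realType) (m : nat) (rho rho' : R)
    (M : set 'rV[R]_m) : set (set 'rV[R]_m) :=
  [set M' | grid_sets rho' M' /\ nbhd (rho / 2) M `<=` nbhd (rho' / 2) M'].

Definition refine_grid (R : realType) (m : nat) (rhohat rhocheck : R)
    (M : set 'rV[R]_m) : set 'rV[R]_m :=
  nbhd (rhohat / 2) M `&` grid rhocheck.

(* Main.v *)
Require Import Defs.
From mathcomp Require Import all_boot all_order all_algebra.
From mathcomp Require Import all_classical all_reals all_analysis.
From mathcomp Require Import zify ring lra.

Set Implicit Arguments.
Unset Strict Implicit.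
Unset Printing Implicit Defensive.

(** The infimum that defines the distance of a point to a subset of a grid is
    attained, because a grid has only finitely many points in a ball
    ([nbhd_gridP]).  Hence [I M] is the set of fine grid points within
    [rhohat / 2] of an actual point of [M] ([refine_gridP]), that is, the set
    of the fine grid points in the cubes of side [rhohat] centred at [M], and
    every part of the theorem becomes a statement about such cubes.

    The behaviour under unions, inclusions and translations is then immediate,
    and so is the bound on the Hausdorff distance.  As distances in a grid are
    multiples of its width ([grid_dist_lt_le]), the neighbourhood of radius half
    the width of a subset of a grid contains no further point of that grid, so
    every fine Voronoi cover of [M] contains [I M].  That [I M] is itself a
    Voronoi cover holds because a vector in the cube of radius [n rho / 2] can be
    rounded to the grid of width [rho] without leaving the cube
    ([grid_round]); ties have to be rounded towards the origin when [n] is odd.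

    As to connectedness, each cube is connected, since every fine grid point in
    it walks to the centre by decreasing the absolute values of all nonzero
    coordinates at once ([linked_to_center]).  The cubes at two coarse points at
    distance at most [rhohat] meet, or contain points one fine step apart
    ([refine_grid_bridge]).  So a coarse path in [M] can be followed by a fine
    path in [I M].

    As to the boundary, let [y] be in the cube of [x] in [M], with a fine
    neighbour [z] outside [I M], and let [w] be a coarse point nearest to [z].
    Then [w] is not in [M], and the distance from [x] to [w] is at most
    [rhohat / 2 + rho + rhohat / 2 < 2 * rhohat].  Being a nonzero multiple of
    [rhohat], it equals [rhohat], so [x] itself is a boundary point of [M]. *)

Import Order.TTheory GRing.Theory Num.Theory.
Import numFieldNormedType.Exports.

Local Open Scope classical_set_scope.
Local Open Scope ring_scope.

(** * Grids and the maximum norm *)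

Lemma row_norm_leP (R : realType) (m : nat) (x : 'rV[R]_m) (r : R) :
  0 <= r -> `|x| <= r <-> forall j, `|x ord0 j| <= r.
Proof.
move=> r0; rewrite -[`|x|]/(mx_norm x) mx_normrE; split.
  by move=> /bigmax_leP[_ h] j; exact: (h (ord0, j)).
by move=> h; apply/bigmax_leP; split=> // -[i j] _ /=; rewrite ord1.
Qed.

Lemma gridP (R : realType) (m : nat) (rho : R) (x : 'rV[R]_m) :
  grid rho x <-> forall j, exists k : int, x ord0 j = rho * k%:~R.
Proof.
split=> [[k _ <-] j|/choice[k xE]]; first by exists (k ord0 j); rewrite !mxE.
exists (\row_j k j) => //; apply/rowP => j.
by rewrite !mxE xE.
Qed.

Lemma gridD (R : realType) (m : nat) (rho : R) (x y : 'rV[R]_m) :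
  grid rho x -> grid rho y -> grid rho (x + y).
Proof.
move=> [k _ <-] [l _ <-]; exists (k + l) => //.
by rewrite -scalerDr map_mxD.
Qed.

Lemma gridN (R : realType) (m : nat) (rho : R) (x : 'rV[R]_m) :
  grid rho x -> grid rho (- x).
Proof. by move=> [k _ <-]; exists (- k) => //; rewrite map_mxN scalerN. Qed.

Lemma sub_grid (R : realType) (m n : nat) (rho : R) :
  @grid R m (n%:R * rho) `<=` grid rho.
Proof.
move=> _ [k _ <-]; apply/gridP => j; exists (n%:Z * k ord0 j).
by rewrite !mxE intrM [n%:R * _]mulrC mulrA.
Qed.

Lemma grid_dist_lt_le (R : realType) (m : nat) (rho : R) (c : nat)
    (x y : 'rV[R]_m) :
  0 < rho -> grid rho x -> grid rho y -> `|x - y| < c.+1%:R * rho ->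
  `|x - y| <= c%:R * rho.
Proof.
move=> rho0 gx gy xy.
have /gridP gxy := gridD gx (gridN gy).
apply/row_norm_leP => [|j]; first by rewrite mulr_ge0// ltW.
have := (row_norm_leP (x - y) (normr_ge0 _)).1 (lexx _) j.
have [k ->] := gxy j => /le_lt_trans/(_ xy).
rewrite normrM (gtr0_norm rho0) mulrC ltr_pM2r// ler_pM2r//.
rewrite -intr_norm !pmulrn ltr_int ler_int; lia.
Qed.

(** * The distance to a subset of a grid is attained *)

(** The next multiple of [rho] above [a] lies at a positive distance from [a],
    so a strict bound by [a + e] with [e] small is a bound by [a]. *)
Lemma multiple_gap (R : realType) (rho a : R) : 0 < rho ->
  \forall e \near 0^'+, forall k : int,
    rho * k%:~R < a + e -> rho * k%:~R <= a.
Proof.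
move=> rho0; have /andP[fl fu] := floor_itv (a / rho).
have gap : 0 < rho * (Num.floor (a / rho) + 1)%:~R - a.
  by rewrite subr_gt0 mulrC -ltr_pdivrMr.
near=> e => k ke.
have /lt_le_trans : e < rho * (Num.floor (a / rho) + 1)%:~R - a.
  by near: e; exact: nbhs_right_lt.
have {ke} : rho * k%:~R < rho * (Num.floor (a / rho) + 1)%:~R.
  apply: lt_trans ke _; rewrite -ltrBrDl.
  by near: e; exact: nbhs_right_lt.
rewrite ltr_pM2l// ltr_int ltzD1 => kf _.
by rewrite mulrC -ler_pdivlMr//; apply: le_trans fl; rewrite ler_int.
Unshelve. all: by end_near. Qed.

Lemma multiple_dist_gap (R : realType) (rho d t : R) : 0 < rho ->
  \forall e \near 0^'+, forall k : int,
    `|t - rho * k%:~R| < d + e -> `|t - rho * k%:~R| <= d.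
Proof.
move=> rho0; near=> e => k; rewrite ltr_norml ler_norml => /andP[lo hi].
have up : rho * k%:~R <= t + d.
  suff : rho * k%:~R < t + d + e by move: k {lo hi}; near: e; exact: multiple_gap.
  by lra.
have dn : rho * (- k)%:~R <= d - t.
  suff : rho * (- k)%:~R < d - t + e.
    by move: (- k) => l; move: l; near: e; exact: multiple_gap.
  by rewrite mulrNz mulrN; lra.
by move: dn; rewrite mulrNz mulrN => dn; apply/andP; split; lra.
Unshelve. all: by end_near. Qed.

(** The substitute for local finiteness of the grid: one [e] serves all grid
    points, because each coordinate excludes an interval above [d] and there
    are finitely many coordinates. *)
Lemma grid_gap (R : realType) (m : nat) (rho d : R) (x : 'rV[R]_m) :
  0 < rho -> 0 <= d ->
  \forall e \near 0^'+, forall a, grid rho a ->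
    `|x - a| < d + e -> `|x - a| <= d.
Proof.
move=> rho0 d0.
have gap : \forall e \near (0 : R)^'+, forall (j : 'I_m) (k : int),
    `|x ord0 j - rho * k%:~R| < d + e -> `|x ord0 j - rho * k%:~R| <= d.
  by apply: filter_forall => j; exact: multiple_dist_gap.
near=> e => a /gridP ga xa; apply/row_norm_leP => // j.
have := (row_norm_leP (x - a) (normr_ge0 _)).1 (lexx _) j.
move=> /le_lt_trans/(_ xa); rewrite !mxE; have [k ->] := ga j.
by move: j k {ga}; near: e.
Unshelve. all: by end_near. Qed.

Lemma nbhd_gridP (R : realType) (m : nat) (rho d : R) (A : set 'rV[R]_m)
    (x : 'rV[R]_m) :
  0 < rho -> 0 <= d -> A `<=` grid rho ->
  nbhd d A x <-> exists2 a, A a & `|x - a| <= d.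
Proof.
move=> rho0 d0 Agrid; rewrite /nbhd /setdist /= image_set1 ereal_sup1.
split=> [inf_le|[a Aa xa]]; last first.
  apply: ge_ereal_inf; exists (`|x - a|)%:E; last by rewrite lee_fin.
  by exists a.
near (0 : R)^'+ => e.
have /ereal_inf_lt[_ [a Aa <-]] :
    (ereal_inf [set (`|x - x'|)%:E | x' in A] < (d + e)%:E)%E.
  apply: le_lt_trans inf_le _; rewrite lte_fin ltrDl.
  by near: e; exact: nbhs_right_gt.
rewrite lte_fin => xa; exists a => //.
move: a {Aa} (Agrid _ Aa) xa; near: e.
exact: grid_gap.
Unshelve. all: by end_near. Qed.

(** * Rounding to a grid *)

(** Rounding up [t - 1 / 2] for nonnegative [t], and symmetrically otherwise,
    sends ties towards 0; thus [t = n / 2] with [n] odd gives [(n - 1) / 2]. *)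
Lemma round_half (R : realType) (n : nat) (t : R) : `|t| <= n%:R / 2 ->
  exists2 k : int, `|t - k%:~R| <= 1 / 2 & `|k%:~R| <= n%:R / 2 :> R.
Proof.
wlog t0 : t / 0 <= t.
  move=> H; have [/H//|/ltW t0 tn] := leP 0 t.
  have [||k tk kn] := H (- t); rewrite ?oppr_ge0 ?normrN//.
  exists (- k); last by rewrite mulrNz normrN.
  by rewrite mulrNz opprK -normrN opprD.
rewrite ger0_norm// => tn.
have /andP[] := ceil_itv (t - 1 / 2).
set k := Num.ceil _; rewrite intrB => k1 k2.
have k0 : 0 <= k by rewrite -ltzD1 -(ltr_int R) intrD; lra.
exists k; first by rewrite ler_norml; apply/andP; split; lra.
rewrite ger0_norm ?ler0z//.
(* [k < t + 1 / 2] gives [2 k < n + 1], and integrality gives [2 k <= n]. *)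
have : (2 * k)%:~R < n.+1%:~R :> R by rewrite intrM -[n.+1%:~R]pmulrn -natr1; lra.
rewrite ltr_int => k2n.
have : (2 * k)%:~R <= n%:~R :> R by rewrite ler_int; lia.
by rewrite intrM -[n%:~R]pmulrn; lra.
Qed.

Lemma grid_round (R : realType) (m n : nat) (rho : R) (t : 'rV[R]_m) :
  0 < rho -> `|t| <= n%:R * rho / 2 ->
  exists2 z, grid rho z & `|t - z| <= rho / 2 /\ `|z| <= n%:R * rho / 2.
Proof.
move=> rho0 tn.
have n0 : 0 <= n%:R * rho / 2 by rewrite (le_trans _ tn).
have scaled j : `|t ord0 j / rho| <= n%:R / 2.
  rewrite normrM normfV (gtr0_norm rho0) ler_pdivrMr// mulrAC.
  by move: j; apply/row_norm_leP.
have /choice[k kP] : forall j, exists k : int,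
    `|t ord0 j / rho - k%:~R| <= 1 / 2 /\ `|k%:~R| <= n%:R / 2 :> R.
  by move=> j; have [k ? ?] := round_half (scaled j); exists k.
exists (\row_j (rho * (k j)%:~R)).
  by apply/gridP => j; exists (k j); rewrite mxE.
split; apply/row_norm_leP => //; first by rewrite divr_ge0// ltW.
- move=> j; have [tk _] := kP j; rewrite !mxE.
  rewrite (_ : _ - _ = rho * (t ord0 j / rho - (k j)%:~R)).
    by rewrite normrM (gtr0_norm rho0) ler_pM2l// -[leRHS]div1r.
  by rewrite mulrBr mulrCA divff ?mulr1// gt_eqF.
- move=> j; have [_ kn] := kP j; rewrite !mxE.
  by rewrite normrM (gtr0_norm rho0) mulrAC mulrC ler_pM2r.
Qed.

(** The bound on the norm in [grid_round] is vacuous for a large multiple of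
    [rho]. *)
Lemma grid_near (R : realType) (m : nat) (rho : R) (t : 'rV[R]_m) :
  0 < rho -> exists2 z, grid rho z & `|t - z| <= rho / 2.
Proof.
move=> rho0.
have [z gz [tz _]] : exists2 z, grid rho z & `|t - z| <= rho / 2 /\
    `|z| <= (Num.bound (2 * `|t| / rho))%:R * rho / 2.
  apply: grid_round => //.
  have : 2 * `|t| / rho < (Num.bound (2 * `|t| / rho))%:R.
    by apply: archi_boundP; rewrite divr_ge0 ?mulr_ge0// ltW.
  by rewrite ltr_pdivrMr//; set c := _ * rho; lra.
by exists z.
Qed.

(** * Linking points of a set by grid paths *)

(** Boolean, as [path] requires; both end points have to lie in [M] to make the
    relation symmetric. *)
Definition adjacent_in (R : realType) (m : nat) (rho : R) (M : set 'rV[R]_m)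
    (u v : 'rV[R]_m) : bool :=
  `[< [/\ M u, M v & `|v - u| <= rho] >].

(** Membership of [x] is asserted separately because the empty path carries no
    adjacency. *)
Definition linked (R : realType) (m : nat) (rho : R) (M : set 'rV[R]_m)
    (x z : 'rV[R]_m) : Prop :=
  M x /\ exists2 q, path (adjacent_in rho M) x q & last x q = z.

Lemma linked_refl (R : realType) (m : nat) (rho : R) (M : set 'rV[R]_m) x :
  M x -> linked rho M x x.
Proof. by move=> Mx; split=> //; exists [::]. Qed.

Lemma linked_adjacent (R : realType) (m : nat) (rho : R) (M : set 'rV[R]_m)
    x z : M x -> M z -> `|z - x| <= rho -> linked rho M x z.
Proof.
move=> Mx Mz xz; split=> //; exists [:: z] => //=.
by rewrite andbT; apply/asboolP.
Qed.

Lemma linked_trans (R : realType) (m : nat) (rho : R) (M : set 'rV[R]_m)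
    x y z : linked rho M x y -> linked rho M y z -> linked rho M x z.
Proof.
move=> [Mx [q xq <-]] [_ [r yr <-]]; split=> //; exists (q ++ r).
  by rewrite cat_path xq.
by rewrite last_cat.
Qed.

Lemma linked_sym (R : realType) (m : nat) (rho : R) (M : set 'rV[R]_m) x z :
  linked rho M x z -> linked rho M z x.
Proof.
move=> [Mx [q xq <-]]; elim: q x Mx xq => [|y q IHq] x Mx /=.
  by move=> _; exact: linked_refl.
move=> /andP[/asboolP[_ My xy] /(IHq _ My) yx]; apply: linked_trans yx _.
by apply: linked_adjacent => //; rewrite distrC.
Qed.

Lemma grid_paths_linked (R : realType) (m : nat) (rho : R) (M : set 'rV[R]_m)
    x z : M `<=` grid rho ->
  (exists2 p, grid_paths rho x z p &
     forall l, (l <= path_length p)%N -> M p`_l) <-> linked rho M x z.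
Proof.
move=> Mgrid; split.
  move=> [[|y q] [//= _ _ yx qz near] Mq].
  rewrite -{}yx; split; first exact: (Mq 0%N).
  exists q; last by rewrite -qz -last_nth.
  apply/(pathP 0) => i iq; apply/asboolP; split.
  - by apply: (Mq i); exact: ltnW.
  - exact: (Mq i.+1).
  - exact: (near i.+1).
move=> [Mx [q /(pathP 0) xq <-]].
have Mq l : (l <= size q)%N -> M (x :: q)`_l.
  by case: l => //= l /xq /asboolP[].
exists (x :: q) => //; split=> //=.
- by move=> l /Mq/Mgrid.
- by rewrite -last_nth.
- by case=> //= l /xq /asboolP[].
Qed.

Lemma connected_setsP (R : realType) (m : nat) (rho : R)
    (M : set 'rV[R]_m) :
  connected_sets rho M <->
  grid_sets rho M /\ forall x x', M x -> M x' -> linked rho M x x'.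
Proof.
split=> -[MS Mp]; split=> // x x' Mx Mx'.
  by apply/grid_paths_linked; [exact: MS.1 | exact: Mp].
by apply/grid_paths_linked; [exact: MS.1 | exact: Mp].
Qed.

Lemma sub_sgz (k : int) :
  [/\ `|k - sgz k| <= `|k|, `|sgz k| <= 1 &
      forall N : nat, `|k| <= N.+1%:Z -> `|k - sgz k| <= N%:Z].
Proof. by split=> [||N]; lia. Qed.

(** Subtracting the sign from every coordinate of [y - x] moves [y] by at most
    [rho] and increases no coordinate of [y - x] in absolute value; iterating
    this reaches [x] without leaving the ball of radius [D]. *)
Lemma linked_to_center (R : realType) (m : nat) (rho D : R)
    (A : set 'rV[R]_m) (x y : 'rV[R]_m) :
  0 < rho -> grid rho x -> grid rho y -> `|y - x| <= D ->
  (forall z, grid rho z -> `|z - x| <= D -> A z) ->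
  linked rho A y x.
Proof.
move=> rho0 gx gy yxD HA.
have D0 : 0 <= D by rewrite (le_trans _ yxD).
have [k _ kE] := gridD gy (gridN gx).
have yE : y = x + rho *: map_mx intr k by rewrite kE addrC subrK.
have {kE} : forall j, `|rho * (k ord0 j)%:~R| <= D.
  by move=> j; move/(row_norm_leP _ D0)/(_ j): yxD; rewrite -kE !mxE.
have [N kN] : exists N : nat, forall j, `|k ord0 j| <= N%:Z.
  exists (\max_j `|k ord0 j|)%N => j.
  by rewrite -abszE lez_nat leq_bigmax.
move: yE; clear yxD gy; elim: N => [|N IHN] in k y kN * => -> kD.
  have -> : k = 0.
    by apply/rowP => j; rewrite mxE; apply/eqP; rewrite -normr_le0.
  rewrite map_mx0 scaler0 addr0; apply: linked_refl.
  by apply: HA => //; rewrite subrr normr0.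
have inA (l : 'rV[int]_m) : (forall j, `|rho * (l ord0 j)%:~R| <= D) ->
    A (x + rho *: map_mx intr l).
  move=> lD; apply: HA; first by apply: gridD => //; exists l.
  by rewrite [x + _]addrC addrK; apply/row_norm_leP => // j; rewrite !mxE.
pose s : 'rV[int]_m := \row_j sgz (k ord0 j).
have kD' j : `|rho * ((k - s) ord0 j)%:~R| <= D.
  apply: le_trans (kD j); rewrite !normrM ler_wpM2l// -!intr_norm ler_int.
  by rewrite !mxE; case: (sub_sgz (k ord0 j)).
have step : linked rho A (x + rho *: map_mx intr k)
    (x + rho *: map_mx intr (k - s)).
  apply: linked_adjacent; [exact: inA | exact: inA |].
  rewrite opprD addrACA subrr add0r -scalerBr -map_mxB.
  apply/row_norm_leP => [|j]; first exact: ltW.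
  rewrite !mxE normrM (gtr0_norm rho0) -[leRHS]mulr1 ler_pM2l//.
  rewrite -intr_norm -[1]/(1%:~R) ler_int addrAC subrr sub0r normrN.
  by case: (sub_sgz (k ord0 j)).
apply: linked_trans step _; apply: IHN (erefl _) kD' => j.
rewrite !mxE; case: (sub_sgz (k ord0 j)) => _ _; apply.
exact: kN.
Qed.

(** * Refinement of a coarse grid set *)

Lemma refine_gridP (R : realType) (m : nat) (rhohat rhocheck : R)
    (M : set 'rV[R]_m) (y : 'rV[R]_m) :
  0 < rhohat -> M `<=` grid rhohat ->
  refine_grid rhohat rhocheck M y <->
  grid rhocheck y /\ exists2 x, M x & `|y - x| <= rhohat / 2.
Proof.
move=> rho0 Mgrid; have half0 : 0 <= rhohat / 2 by rewrite divr_ge0// ltW.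
rewrite /refine_grid /=; split=> [[yM yg]|[yg yM]]; split=> //.
  exact/(nbhd_gridP y rho0 half0 Mgrid).
exact/(nbhd_gridP y rho0 half0 Mgrid).
Qed.

Lemma sub_refine_grid (R : realType) (m n : nat) (rho : R)
    (M : set 'rV[R]_m) : 0 < n%:R * rho -> M `<=` grid (n%:R * rho) ->
  M `<=` refine_grid (n%:R * rho) rho M.
Proof.
move=> nrho0 Mgrid x Mx; apply/refine_gridP => //; split.
  by apply: sub_grid; exact: Mgrid.
by exists x => //; rewrite subrr normr0 divr_ge0// ltW.
Qed.

Lemma refine_grid_sets (R : realType) (m n : nat) (rho : R)
    (M : set 'rV[R]_m) : 0 < n%:R * rho -> grid_sets (n%:R * rho) M ->
  grid_sets rho (refine_grid (n%:R * rho) rho M).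
Proof.
move=> nrho0 [Mgrid [x Mx]]; split; first by move=> y [].
by exists x; exact: sub_refine_grid.
Qed.

(** With [v := (x' - x) / n], which is a fine grid vector of norm at most [rho],
    the points are [x + (n / 2) v] and [x' - (n / 2) v] (integer division):
    they coincide for even [n] and differ by [v] for odd [n]. *)
Lemma refine_grid_bridge (R : realType) (m n : nat) (rho : R)
    (x x' : 'rV[R]_m) : 0 < rho -> (0 < n)%N ->
  grid (n%:R * rho) x -> grid (n%:R * rho) x' -> `|x' - x| <= n%:R * rho ->
  exists y y', [/\ grid rho y /\ grid rho y', `|y - x| <= n%:R * rho / 2,
    `|y' - x'| <= n%:R * rho / 2 & `|y' - y| <= rho].
Proof.
move=> rho0 n0 gx gx' xx'.
have [v gv vE] : exists2 v, grid rho v & x' - x = v *+ n.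
  have [k _ <-] := gridD gx' (gridN gx).
  exists (rho *: map_mx intr k); first by exists k.
  by rewrite -[RHS]scaler_nat scalerA.
have gvn i : grid rho (v *+ i).
  elim: i => [|i IHi]; last by rewrite mulrS; exact: gridD.
  by apply/gridP => j; exists 0; rewrite !mxE mulr0.
have nR0 : 0 < n%:R :> R by rewrite ltr0n.
have vrho : `|v| <= rho.
  by move: xx'; rewrite vE normrMn -[leLHS]mulr_natl ler_pM2l.
have vhalf : `|v *+ n./2| <= n%:R * rho / 2.
  rewrite normrMn -[leLHS]mulr_natl mulrAC; apply: ler_pM => //.
  rewrite ler_pdivlMr// -natrM ler_nat; lia.
exists (x + v *+ n./2), (x' - v *+ n./2); split.
- split; apply: gridD => //; [exact: sub_grid gx | exact: sub_grid gx' |].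
  exact: gridN.
- by rewrite [x + _]addrC addrK.
- by rewrite addrAC subrr sub0r normrN.
- have -> : x' - v *+ n./2 - (x + v *+ n./2) = v *+ odd n.
    apply/eqP; rewrite opprD addrACA vE -opprD subr_eq -!mulrnDr; apply/eqP.
    by congr (_ *+ _); lia.
  by rewrite normrMn; case: odd => //; rewrite mulr0n ltW.
Qed.

(** Each step of a coarse path in [M] is replaced by a fine path from the
    centre of the first cube to its bridge point, a step across, and a fine path
    to the centre of the second cube. *)
Lemma refine_grid_connected (R : realType) (m n : nat) (rho : R)
    (M : set 'rV[R]_m) : 0 < rho -> (0 < n)%N ->
  connected_sets (n%:R * rho) M ->
  connected_sets rho (refine_grid (n%:R * rho) rho M).
Proof.
move=> rho0 n0 /connected_setsP[MS Mlinked]; have Mgrid := MS.1.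
have nrho0 : 0 < n%:R * rho by rewrite mulr_gt0 ?ltr0n.
apply/connected_setsP; split; first exact: refine_grid_sets.
move=> y y'.
set IM := refine_grid _ _ _.
have cube x z : M x -> grid rho z -> `|z - x| <= n%:R * rho / 2 ->
    linked rho IM z x.
  move=> Mx gz zx; apply: (linked_to_center rho0 _ gz zx).
    by apply: sub_grid; exact: Mgrid.
  by move=> w gw wx; apply/refine_gridP => //; split=> //; exists x.
have linkM x x' : linked (n%:R * rho) M x x' -> linked rho IM x x'.
  move=> [Mx [q xq <-]]; elim: q x Mx xq => [|x1 q IHq] x Mx /=.
    move=> _; apply: cube => //; first by apply: sub_grid; exact: Mgrid.
    by rewrite subrr normr0 divr_ge0// ltW.
  move=> /andP[/asboolP[_ Mx1 xx1] /(IHq _ Mx1)]; apply: linked_trans.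
  have [z [z1 [[gz gz1] zx z1x1 zz1]]] :=
    refine_grid_bridge rho0 n0 (Mgrid _ Mx) (Mgrid _ Mx1) xx1.
  have lz := cube _ _ Mx gz zx; have lz1 := cube _ _ Mx1 gz1 z1x1.
  apply: linked_trans (linked_sym lz) (linked_trans _ lz1).
  exact: linked_adjacent lz.1 lz1.1 zz1.
move=> /(refine_gridP _ _ nrho0 Mgrid)[gy [x Mx yx]].
move=> /(refine_gridP _ _ nrho0 Mgrid)[gy' [x' Mx' yx']].
apply: linked_trans (cube _ _ Mx gy yx) _.
apply: linked_trans (linkM _ _ (Mlinked _ _ Mx Mx')) _.
exact: linked_sym (cube _ _ Mx' gy' yx').
Qed.

(** The coarse boundary point is the centre [x] of any cube that contains [y].
    The condition [1 < n] makes [rho < n rho], so that the distance from [x] to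
    the coarse point nearest to [z] stays below twice the coarse width. *)
Lemma refine_grid_boundary0 (R : realType) (m n : nat) (rho : R)
    (M : set 'rV[R]_m) : 0 < rho -> (1 < n)%N -> M `<=` grid (n%:R * rho) ->
  boundary0 rho (refine_grid (n%:R * rho) rho M) `<=`
  refine_grid (n%:R * rho) rho (boundary0 (n%:R * rho) M).
Proof.
move=> rho0 n1 Mgrid.
have nrho0 : 0 < n%:R * rho by rewrite mulr_gt0 ?ltr0n// ltnW.
move=> y [/(refine_gridP _ _ nrho0 Mgrid)[gy [x Mx yx]] [z [zM gz] yz]].
apply/refine_gridP => //; first by move=> u [/Mgrid].
split=> //; exists x => //; split=> //.
have [w gw zw] := grid_near z nrho0.
(* [z] would lie in the refinement, being within half a coarse width of [w]. *)
have wM : ~ M w.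
  by move=> Mw; apply: zM; apply/refine_gridP => //; split=> //; exists w.
exists w => //; apply/le_anti/andP; split.
  rewrite -[leRHS]mul1r; apply: (grid_dist_lt_le (c := 1) nrho0 (Mgrid _ Mx) gw).
  have rho_lt : rho < n%:R * rho by rewrite ltr_pMl// ltr1n.
  have := ler_distD y x w; have := ler_distD z y w.
  rewrite (distrC x y) yz; lra.
rewrite leNgt; apply/negP => xw; apply: wM.
(* A coarse distance below one coarse width is zero. *)
have : `|x - w| <= 0%:R * (n%:R * rho).
  by apply: (grid_dist_lt_le nrho0 (Mgrid _ Mx) gw); rewrite mul1r.
by rewrite mul0r normr_le0 subr_eq0 => /eqP <-.
Qed.

Theorem theorem23 (R : realType) (m : nat) (m_gt0 : (0 < m)%N)
    (rhocheck rhohat : R) (rhocheck_gt0 : 0 < rhocheck) (rhohat_gt0 : 0 < rhohat)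
    (n : nat) (n_ge2 : (2 <= n)%N) (rhohatE : rhohat = n%:R * rhocheck) :
  let I : set 'rV[R]_m -> set 'rV[R]_m := refine_grid rhohat rhocheck in
  (forall M, grid_sets rhohat M -> grid_sets rhocheck (I M)) /\
  I (grid rhohat) = grid rhocheck /\
  (forall M M', grid_sets rhohat M -> grid_sets rhohat M' ->
     I (M `|` M') = I M `|` I M') /\
  (forall M M', grid_sets rhohat M -> grid_sets rhohat M' ->
     M `<=` M' -> I M `<=` I M') /\
  (forall M x, grid_sets rhohat M -> grid rhohat x ->
     I [set x + y | y in M] = [set x + y | y in I M]) /\
  (forall M, grid_sets rhohat M ->
     (hausdorff_dist (I M) M <= (rhohat / 2)%:E)%E) /\
  (forall M, grid_sets rhohat M ->
     voronoi_covers rhohat rhocheck M (I M)) /\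
  (forall M M', grid_sets rhohat M ->
     voronoi_covers rhohat rhocheck M M' -> I M `<=` M') /\
  (forall M, connected_sets rhohat M -> connected_sets rhocheck (I M)) /\
  (forall M, grid_sets rhohat M ->
     boundary0 rhocheck (I M) `<=` I (boundary0 rhohat M)).
Proof.
subst rhohat; move: rhohat_gt0; set rhohat := n%:R * rhocheck => rhohat_gt0 I.
have half_ge0 : 0 <= rhohat / 2 by rewrite divr_ge0// ltW.
have half'_ge0 : 0 <= rhocheck / 2 by rewrite divr_ge0// ltW.
have hatcheck : @grid R m rhohat `<=` grid rhocheck by exact: sub_grid.
have IP M y : M `<=` grid rhohat ->
    I M y <-> grid rhocheck y /\ exists2 x, M x & `|y - x| <= rhohat / 2.
  exact: refine_gridP.
have subI M : M `<=` grid rhohat -> M `<=` I M by exact: sub_refine_grid.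
have IS M : grid_sets rhohat M -> grid_sets rhocheck (I M).
  exact: refine_grid_sets.
split; [|split; [|split; [|split; [|split; [|split; [|split; [|split; [|split]]]]]]]].
- exact: IS.
- apply/seteqP; split=> [y []//|y gy]; apply/IP => //; split=> //.
  exact: grid_near.
- move=> M M' [Mg _] [M'g _].
  have MM'g : M `|` M' `<=` grid rhohat by rewrite subUset.
  apply/seteqP; split=> y.
    move=> /(IP _ _ MM'g)[gy [x [Mx|Mx] yx]]; [left|right];
      by apply/IP => //; split=> //; exists x.
  move=> [/(IP _ _ Mg)|/(IP _ _ M'g)] [gy [x Mx yx]];
    by apply/IP => //; split=> //; exists x => //; [left + right].
- move=> M M' [Mg _] [M'g _] MM' y /(IP _ _ Mg)[gy [x Mx yx]].
  by apply/IP => //; split=> //; exists x => //; exact: MM'.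
- move=> M x [Mg _] gx.
  have xMg : [set x + y | y in M] `<=` grid rhohat.
    by move=> _ [y /Mg gy <-]; exact: gridD.
  apply/seteqP; split=> [y /(IP _ _ xMg)[gy [_ [z Mz <-] yxz]]|_ [y + <-]].
    exists (y - x); last by rewrite addrC subrK.
    apply/IP => //; split; last by exists z => //; rewrite -addrA -opprD.
    by apply: gridD => //; apply: gridN; exact: hatcheck.
  move=> /(IP _ _ Mg)[gy [z Mz yz]]; apply/IP => //; split.
    by apply: gridD => //; exact: hatcheck.
  by exists (x + z); [exists z|rewrite opprD addrACA subrr add0r].
- move=> M [Mg _]; rewrite /hausdorff_dist ge_max; apply/andP; split.
    apply: ge_ereal_sup => _ [y /(IP _ _ Mg)[_ [x Mx yx]] <-].
    apply: ge_ereal_inf; exists (`|y - x|)%:E; last by rewrite lee_fin.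
    by exists x.
  apply: ge_ereal_sup => _ [x Mx <-].
  apply: ge_ereal_inf; exists (`|x - x|)%:E; last by rewrite lee_fin subrr normr0.
  by exists x => //; exact: subI.
- move=> M MS; have Mg := MS.1; split; first exact: IS.
  move=> y /(nbhd_gridP y rhohat_gt0 half_ge0 Mg)[x Mx yx].
  apply/(nbhd_gridP y rhocheck_gt0 half'_ge0 (IS _ MS).1).
  have [z gz [yxz zn]] := grid_round rhocheck_gt0 yx.
  exists (x + z); last by rewrite opprD addrA.
  apply/IP => //; split; first by apply: gridD => //; exact/hatcheck/Mg.
  by exists x => //; rewrite addrAC subrr add0r.
- move=> M M' [Mg _] [[M'g _] cover] y [yM gy].
  have /(nbhd_gridP y rhocheck_gt0 half'_ge0 M'g)[w M'w yw] := cover _ yM.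
  have : `|y - w| <= 0%:R * rhocheck.
    by apply: (grid_dist_lt_le rhocheck_gt0 gy (M'g _ M'w)); rewrite mul1r; lra.
  by rewrite mul0r normr_le0 subr_eq0 => /eqP ->.
- by move=> M; apply: refine_grid_connected => //; exact: ltnW.
- by move=> M [Mg _]; exact: refine_grid_boundary0.
Qed.
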